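(* Let $(T,X)$ be an invertible semiflow on a compact Hausdorff space $X$, with reflection $(X,T)$. Then: (1) $(T,X)$ is equicontinuous if and only if $(X,T)$ is equicontinuous. (2) $(T,X)$ is minimal and distal if and only if $(X,T)$ is minimal and distal. (3) $(T,X)$ is distal if and only if $(X,T)$ is distal.
   Context: $X$ is a nonempty compact Hausdorff space, $\mathscr U_X$ is its compatible uniformity (symmetric entourages), and $T$ is a discrete infinite semigroup with identity $e$. A semiflow $(T,X)$ is a continuous map $T\times X\to X$, $(t,x)\mapsto tx$, with $ex=x$ and $t(sx)=(ts)x$. It is invertible if for every $t\in T$ the map $x\mapsto tx$ is a bijection (hence a homeomorphism) of $X$. The reflection $(X,T)$ of an invertible semiflow is the right action $X\times T\to X$, $(x,t)\mapsto xt:=t^{-1}x$. $(T,X)$ is equicontinuous if for every $\varepsilon\in\mathscr U_X$ there is $\delta\in\mathscr U_X$ such that $(x,y)\in\delta$ implies $(tx,ty)\in\varepsilon$ for all $t\in T$; minimal if $Tx$ is dense in $X$ for every $x\in X$; distal if for all $x\ne y$ in $X$ there is $\alpha\in\mathscr U_X$ with $(tx,ty)\notin\alpha$ for all $t\in T$. The same notions for $(X,T)$ are obtained by replacing the maps $x\mapsto tx$ by the maps $x\mapsto xt=t^{-1}x$, $t\in T$ (so orbits are $xT=\{t^{-1}x:t\in T\}$). *)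

(* Defs.v *)
From HB Require Import structures.
From mathcomp Require Import all_boot all_fingroup.
From mathcomp Require Import all_classical.
From mathcomp Require Import topology.

Set Implicit Arguments.
Unset Strict Implicit.
Unset Printing Implicit Defensive.

Local Open Scope classical_set_scope.
Local Open Scope relation_scope.

(* Joint continuity is with respect to the discrete topology on T. *)
Record semiflow (T : monoidType) (X : topologicalType) := Semiflow {
  act :> T -> X -> X;
  act_continuous : continuous (fun p : discrete_topology T * X => act p.1 p.2);
  act1 : forall x, act 1%g x = x;
  actM : forall t s x, act t (act s x) = act (t * s)%g x
}.

Definition invertible (T : monoidType) (X : topologicalType)
    (F : semiflow T X) : Prop :=
  forall t, bijective (F t).

(* The right action of the reflection: [reflection F t x] is xt := t^{-1} x,
   the preimage of x under F t (x is a default value, never used when F is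
   invertible). *)
Definition reflection (T : monoidType) (X : topologicalType)
    (F : semiflow T X) (t : T) (x : X) : X :=
  xget x (F t @^-1` [set x]).

Lemma reflectionK (T : monoidType) (X : topologicalType) (F : semiflow T X) :
  invertible F -> forall t, cancel (reflection F t) (F t).
Proof.
move=> Fbij t x; rewrite /reflection; case: xgetP => //= noF.
by have [g _ gK] := Fbij t; case: (noF (g x)); rewrite /= gK.
Qed.

Lemma actK (T : monoidType) (X : topologicalType) (F : semiflow T X) :
  invertible F -> forall t, cancel (F t) (reflection F t).
Proof.
by move=> Fbij t x; apply: (bij_inj (Fbij t)); rewrite reflectionK.
Qed.

Lemma reflectionM (T : monoidType) (X : topologicalType) (F : semiflow T X) :
  invertible F -> forall t s x,
  reflection F s (reflection F t x) = reflection F (t * s)%g x.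
Proof.
move=> Fbij t s x; apply: (bij_inj (Fbij (t * s)%g)).
by rewrite -actM !reflectionK.
Qed.

Definition sym_entourage (X : uniformType) : set_system (X * X) :=
  [set A | entourage A /\ A^-1 = A].

(* The dynamical notions below are about a family f of self-maps of X; they
   apply both to x |-> tx (a semiflow F) and to x |-> xt (reflection F). *)

(* Uniform equicontinuity, unlike the pointwise [equicontinuous]. *)
Definition equicontinuous_action (T : Type) (X : uniformType)
    (f : T -> X -> X) : Prop :=
  forall A, sym_entourage A -> exists2 B, sym_entourage B &
    forall x y : X, B (x, y) -> forall t, A (f t x, f t y).

Definition minimal_action (T : Type) (X : topologicalType)
    (f : T -> X -> X) : Prop :=
  forall x, dense (range (f^~ x)).

Definition distal_action (T : Type) (X : uniformType)
    (f : T -> X -> X) : Prop :=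
  forall x y : X, x <> y -> exists2 A, sym_entourage A &
    forall t, ~ A (f t x, f t y).

(* Main.v *)
(* Equicontinuity: by pigeonhole on a finite net, for every t some positive
   power of x |-> tx is uniformly close to the identity, so x |-> t^{-1}x is
   uniformly close to a nonnegative power of x |-> tx, and these powers are
   equicontinuous.

   Distality: let S be the enveloping semigroup, the pointwise closure of
   {x |-> tx} in X^X. Distality makes every element of S injective, so the
   identity is the only possible idempotent of S; the Ellis-Numakura theorem
   in the closed subsemigroup S t then gives p in S with p t = id, that is
   t^{-1} in S. Hence the pair (t^{-1}x, t^{-1}y) is a limit of pairs (sx, sy).

   Minimality: if the reflection is distal, the same argument applied to it puts
   every x |-> tx in its enveloping semigroup, so the closure of xT contains
   Tx. *)
Require Import Defs.
From HB Require Import structures.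
From mathcomp Require Import all_boot all_fingroup finmap.
From mathcomp Require Import all_classical.
From mathcomp Require Import topology.

Set Implicit Arguments.
Unset Strict Implicit.
Unset Printing Implicit Defensive.

Local Open Scope classical_set_scope.

(** * Topological preliminaries and idempotents of compact semigroups *)

Lemma closure_image_sub (Y Z : topologicalType) (f : Y -> Z)
    (A : set Y) (B : set Z) :
  continuous f -> f @` A `<=` B -> f @` closure A `<=` closure B.
Proof.
move=> fc AB _ [y Ay <-] V /fc /Ay [a [Aa Va]].
by exists (f a); split=> //; apply: AB; exists a.
Qed.

Lemma compact_bij_inv_continuous (X Y : topologicalType)
    (f : X -> Y) (g : Y -> X) :
  compact [set: X] -> hausdorff_space Y -> continuous f ->
  cancel f g -> cancel g f -> continuous g.
Proof.
move=> cX hY fc fK gK; apply/continuous_closedP => A clA.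
have -> : g @^-1` A = f @` A.
  apply/seteqP; split=> [y Ay|_ [x Ax <-]]; last by rewrite /= fK.
  by exists (g y) => //; rewrite gK.
apply: compact_closed => //; apply: continuous_compact.
  exact: continuous_subspaceT.
exact: (subclosed_compact clA cX).
Qed.

(** Zorn yields a minimal closed subsemigroup [M] of [S]. For [u] in [M], minimality forces
    [M u = M], so [v u = u] for some [v] in [M]; the [v] in [M] with [v u = u] then form a nonempty
    closed subsemigroup, again all of [M], and it contains [u]. *)
Lemma Ellis_Numakura (E : topologicalType) (op : E -> E -> E)
    (S : set E) :
  hausdorff_space E -> associative op -> (forall q, continuous (op^~ q)) ->
  compact S -> S !=set0 -> (forall p q, S p -> S q -> S (op p q)) ->
  exists2 u, S u & op u u = u.
Proof.
move=> hE opA opc cS [s0 Ss0] Sop.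
(* Complements turn the search for a minimal closed set into one for a maximal open set, the form in
   which [Zorn_bigcup] applies. *)
pose P (C : set E) := [/\ open C, (S `\` C) !=set0 &
  forall p q, (S `\` C) p -> (S `\` C) q -> (S `\` C) (op p q)].
have [|C [[oC [u [Su Cu]] Cop] Cmax]] := @Zorn_bigcup E P.
  move=> F FP Ftot; split.
  - by apply: bigcup_open => C /FP[].
  - have [[C0 FC0]|F0] := pselect (F !=set0); last first.
      by exists s0; split=> // -[C FC]; case: F0; exists C.
    (* The complements in [S] of the members of the chain form a filter base; a cluster point in [S]
       avoids every [C], since [C] is open. *)
    pose G := filter_from F (fun C => S `\` C).
    have GF : ProperFilter G.
      apply: filter_from_proper; last by move=> C /FP[].
      apply: filter_from_filter; first by exists C0.
      move=> A B FA FB; have [AB|BA] := Ftot _ _ FA FB.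
      + exists B => // x [Sx Bx].
        by split; split=> //; apply: contra_not Bx => /AB.
      + exists A => // x [Sx Ax].
        by split; split=> //; apply: contra_not Ax => /BA.
    have GS : G S by exists C0 => // x [].
    have [p [Sp pcl]] := cS _ _ GS.
    exists p; split=> // -[C FC Cp]; have [oC _ _] := FP _ FC.
    have [x [[_ nCx] Cx]] : (S `\` C) `&` C !=set0.
      by apply: pcl; [exists C | exact: open_nbhs_nbhs].
    exact: nCx.
  - move=> p q [Sp Cp] [Sq Cq]; split; first exact: Sop.
    move=> [C FC Cpq]; have [_ _ Cop] := FP _ FC.
    have [||_] := Cop p q; last exact.
      by split=> // Cx; apply: Cp; exists C.
    by split=> // Cx; apply: Cq; exists C.
have sub_eq (M : set E) : closed M -> M !=set0 -> M `<=` S `\` C ->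
    (forall p q, M p -> M q -> M (op p q)) -> M = S `\` C.
  move=> clM [m Mm] MC Mop; apply/seteqP; split=> // x [Sx Cx].
  apply: contrapT => Mx.
  have MS : S `\` ~` M = M.
    rewrite setDE setCK; apply/seteqP; split=> [y []//|y My].
    by split=> //; have [] := MC _ My.
  apply: (Cmax (~` M)).
    split; last by move=> /(_ x Mx).
    by move=> y Cy /MC[].
  by split; [exact: closed_openC | rewrite MS; exists m | rewrite MS].
have cM : compact (S `\` C) by apply: compact_closedI => //; exact: open_closedC.
have Mu : op^~ u @` (S `\` C) = S `\` C.
  apply: sub_eq.
  - apply: compact_closed => //; apply: continuous_compact => //.
    exact: continuous_subspaceT.
  - by exists (op u u), u.
  - by move=> _ [p Mp <-]; apply: Cop.
  - move=> _ _ [p Mp <-] [q Mq <-]; exists (op (op p u) q).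
      by apply: (Cop) => //; exact: Cop.
    by rewrite !opA.
have [v Mv vu] : (op^~ u @` (S `\` C)) u by rewrite Mu.
have NE : (S `\` C) `&` op^~ u @^-1` [set u] = S `\` C.
  apply: sub_eq.
  - apply: closedI; first exact: compact_closed.
    apply: preimage_closed => //.
    exact/accessible_closed_set1/hausdorff_accessible.
  - by exists v.
  - by move=> x [].
  - move=> p q [Mp /= pu] [Mq /= qu]; split; first exact: Cop.
    by rewrite /= -opA qu.
have [_ /= uu] : ((S `\` C) `&` op^~ u @^-1` [set u]) u by rewrite NE.
by exists u.
Qed.

(** * The space of self-maps under pointwise convergence *)

Lemma continuous_ptws (X Z : topologicalType) (Y : uniformType)
    (f : Z -> {ptws X -> Y}) :
  (forall x, continuous (fun z => f z x)) -> continuous f.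
Proof. by move=> fc z; apply/pointwise_cvgP => x; exact: fc. Qed.

Lemma continuous_eval (X : topologicalType) (Y : uniformType) (x : X) :
  continuous (fun p : {ptws X -> Y} => p x).
Proof. by move=> p; apply: (proj_continuous (K := fun=> Y) (i := x)). Qed.

Lemma compact_ptws (X Y : topologicalType) :
  compact [set: Y] -> compact [set: {ptws X -> Y}].
Proof.
move=> cY; have := @tychonoff X (fun=> Y) (fun=> setT) (fun=> cY).
by congr compact; apply/seteqP; split.
Qed.

Lemma sym_entourage_split (X : uniformType) (A : set (X * X)) :
  entourage A -> exists2 B, sym_entourage B &
    forall x z y : X, B (x, z) -> B (z, y) -> A (x, y).
Proof.
move=> entA; exists (split_ent A `&` (split_ent A)^-1)%relation.
  split; first exact: entourage_invI.
  by apply/seteqP; split=> -[x y] [].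
by move=> x z y [xz _] [zy _]; exact: entourage_split entA xz zy.
Qed.

(** * Enveloping semigroups, distality and minimality *)

Section Enveloping.
Context {T : Type} {X : uniformType}.
Implicit Types g h : T -> X -> X.

Definition enveloping g : set {ptws X -> X} :=
  closure (range (g : T -> {ptws X -> X})).

(** Leaving [r] unspecified covers both [F] and its reflection, which multiply in opposite
    orders. *)
Definition subsemigroup_action g :=
  forall t s, exists r, forall x, g t (g s x) = g r x.

(** Two passages to the closure: first in the right factor, as composing with the continuous [g t]
    on the left is continuous, then in the left factor, as composing with any fixed [q] on the right
    is continuous. *)
Lemma enveloping_comp g :
  (forall t, continuous (g t)) -> subsemigroup_action g ->
  forall p q, enveloping g p -> enveloping g q -> enveloping g (p \o q).
Proof.
move=> gc gM p q Sp Sq.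
have gS t r : enveloping g r -> enveloping g (g t \o r).
  move=> Sr; apply: (@closure_image_sub {ptws X -> X} {ptws X -> X}
      (fun r => g t \o r) (range g) (range g)).
  - apply: continuous_ptws => x r' /=.
    apply: (@continuous_comp {ptws X -> X} X X (fun p => p x) (g t)).
      exact: continuous_eval.
    exact: gc.
  - move=> _ [_ [s _ <-] <-]; have [u gu] := gM t s.
    by exists u => //; apply/funext => x; rewrite /= gu.
  - by exists r.
have -> : enveloping g = closure (enveloping g).
  exact/closure_id/closed_closure.
apply: (@closure_image_sub {ptws X -> X} {ptws X -> X}
    (fun r => r \o q) (range g) (enveloping g)).
- by apply: continuous_ptws => x; exact: continuous_eval.
- by move=> _ [_ [s _ <-] <-]; exact: gS.
- by exists p.
Qed.

Lemma enveloping_approx g p (A : set (X * X)) (x y : X) :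
  enveloping g p -> entourage A ->
  exists t, A (p x, g t x) /\ A (p y, g t y).
Proof.
move=> Sp entA.
have nbhsA z : nbhs (p : {ptws X -> X}) [set q : {ptws X -> X} | A (p z, q z)].
  have /cvg_app_entourageP := @continuous_eval X X z p.
  by apply.
have [_ [[t _ <-] /= [Ax Ay]]] := Sp _ (filterI (nbhsA x) (nbhsA y)).
by exists t.
Qed.

(** If [p x = p y], some [g t] sends both points close to this common value, so [x] and [y] are
    proximal. *)
Lemma distal_enveloping_inj g p :
  distal_action g -> enveloping g p -> injective p.
Proof.
move=> gD Sp x y pxy; apply: contrapT => /gD[A [entA _] gA].
have [B [entB Bsym] BA] := sym_entourage_split entA.
have [t [Bx By]] := enveloping_approx x y Sp entB.
apply: (gA t); apply: (BA _ (p x)); last by rewrite pxy.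
by rewrite -Bsym.
Qed.

Lemma enveloping_inverse g (t : T) (h : X -> X) :
  compact [set: X] -> hausdorff_space X ->
  (forall t, continuous (g t)) -> subsemigroup_action g ->
  distal_action g -> cancel h (g t) -> enveloping g h.
Proof.
move=> cX hX gc gM gD gK.
have Sop := enveloping_comp gc gM.
have cS : compact (enveloping g).
  apply: (subclosed_compact _ (@compact_ptws X X cX)) => //.
  exact: closed_closure.
have comp_r q : continuous (fun p : {ptws X -> X} => (p \o q) : {ptws X -> X}).
  by apply: continuous_ptws => x; exact: continuous_eval.
have Sg s : enveloping g (g s) by apply: subset_closure; exists s.
pose St : set {ptws X -> X} := (fun p => p \o g t) @` enveloping g.
have [||||_ [p Sp <-] pp] := @Ellis_Numakura {ptws X -> X}
  (fun p q => p \o q) St (hausdorff_product (fun=> hX)) _ comp_r.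
- by [].
- by apply: continuous_compact => //; exact: continuous_subspaceT.
- by exists (g t \o g t), (g t).
- move=> _ _ [p Sp <-] [q Sq <-]; exists (p \o (g t \o q)) => //.
  by apply: (Sop) => //; exact: Sop.
have -> // : h = p.
(* The map [p \o g t] lies in the enveloping semigroup, hence is injective, and it sends both [p x]
   and [h x] to [p x]. *)
apply/funext => x; have /= := congr1 (@^~ (h x)) pp; rewrite gK => e.
by rewrite [RHS](distal_enveloping_inj gD (Sop _ _ Sp (Sg t)) _ : _ = h x) //= gK.
Qed.

(** Were [h t x] and [h t y] too close, so would be an approximating pair [g s x], [g s y]. *)
Lemma inverse_distal g h :
  distal_action g -> (forall t, enveloping g (h t)) -> distal_action h.
Proof.
move=> gD Sh x y xy; have [A [entA _] gA] := gD _ _ xy.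
have [B [entB Bsym] BA] := sym_entourage_split entA.
have [C [entC Csym] CB] := sym_entourage_split entB.
exists C => // t Chxy.
have [s [Cx Cy]] := enveloping_approx x y (Sh t) entC.
apply: (gA s); apply: (BA _ (h t y)).
  by apply: (CB _ (h t x)) => //; rewrite -Csym.
by apply: (CB _ (h t y)) => //; exact: entourage_refl.
Qed.

Lemma inverse_minimal g h :
  minimal_action g -> (forall t, enveloping h (g t)) -> minimal_action h.
Proof.
move=> gmin Sg x O O0 oO; have [z [Oz [t _ e]]] := gmin x O O0 oO.
have nbhsO : nbhs (g t : {ptws X -> X}) [set q : {ptws X -> X} | O (q x)].
  by apply: (@continuous_eval X X x (g t)); rewrite /= e; exact: open_nbhs_nbhs.
have [_ [[s _ <-] Ohx]] := Sg t _ nbhsO.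
by exists (h s x); split=> //; exists s.
Qed.
End Enveloping.

(** * Finite nets, recurrence and equicontinuity *)

Lemma compact_finite_net (X : uniformType) (A : set (X * X)) :
  compact [set: X] -> entourage A ->
  exists s : {fset X}, forall x, exists2 y, y \in s & A (y, x).
Proof.
move=> /compact_near_coveringP cX entA.
(* The filter of large finite sets: near [x], every finite set containing [x] works, and
   near-covering compactness makes one set work everywhere. *)
pose F := filter_from [set: {fset X}] (fun s => [set s' | (s `<=` s')%fset]).
have FF : Filter F.
  apply: filter_from_filter; first by exists fset0.
  move=> s s' _ _; exists (s `|` s')%fset => // r /=.
  by rewrite fsubUset => /andP.
have [x _|s _ sA] := cX _ F (fun s x => exists2 y, y \in s & A (y, x)) FF.
  exists (xsection A x, [set s | x \in s]).
    split; first exact: nbhs_entourage.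
    exists [fset x]%fset => // s /fsubsetP; apply; exact: fset11.
  by move=> [y s] /= [/xsectionP xy xs]; exists x.
by exists s => x; apply: (sA s) => //=; exact: fsubset_refl.
Qed.

(* Pigeonhole on the relative positions of f^n y and z for y, z in a finite
   net: two powers f^n, f^m with the same positions are uniformly close. *)
Lemma uniform_recurrence (X : uniformType) (f : X -> X) (A : set (X * X)) :
  compact [set: X] -> bijective f ->
  equicontinuous_action (fun n => iter n f) -> entourage A ->
  exists n, forall x, A (x, iter n.+1 f x).
Proof.
move=> cX [f' fK f'K] feq entA.
have [A' [entA' _] A'A] := sym_entourage_split entA.
have [C Cent CA'] := sym_entourage_split entA'; have [_ Csym] := Cent.
have [B [entB Bsym] BC] := feq C Cent.
have [s snet] := compact_finite_net cX entB.
pose code n := [set ij : s * s | `[< B (val ij.1, iter n f (val ij.2)) >]]%SET.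
(* The chain is [f^n x], [f^n y], [z], [f^m y], [f^m x]; exponent [0] in [BC] turns [B]-closeness
   into [C]-closeness. *)
have close n m : code n = code m -> forall x, A (iter n f x, iter m f x).
  move=> nm x; have [y ys Byx] := snet x.
  have [z zs Bz] := snet (iter n f y).
  have : ([` zs], [` ys])%fset \in code n by rewrite inE; exact/asboolP.
  rewrite nm inE => /asboolP /= Bz'.
  apply: (A'A _ z).
    apply: (CA' _ (iter n f y)); first by apply: BC; rewrite -Bsym.
    by rewrite -Csym; exact: (BC _ _ Bz 0).
  by apply: (CA' _ (iter m f y)); [exact: (BC _ _ Bz' 0) | exact: BC].
have [n [m [nm cnm]]] : exists n m, n < m /\ code n = code m.
  apply: contrapT => inj_code.
  pose c (i : 'I_(#|{set s * s}|.+1)) := code i.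
  suff /leq_card : injective c by rewrite card_ord ltnn.
  move=> i j cij; apply/val_inj; apply: contrapT => /eqP.
  by rewrite neq_ltn => /orP[] ij; apply: inj_code;
    [exists i, j | exists j, i].
(* The predecessor offsets the [n.+1] of the statement. Closeness of [f^n] and [f^m] is used at the
   [n]-th backward iterate of [x]. *)
exists (m - n).-1 => x; rewrite prednK ?subn_gt0 //.
have iterK k : cancel (iter k f') (iter k f).
  by elim: k => // k IH y; rewrite iterSr iterS f'K IH.
have := close _ _ cnm (iter n f' x).
by rewrite iterK -{1}(subnK (ltnW nm)) iterD iterK.
Qed.

(** Positive powers of [g t] belong to the family; the intersection with [A] takes care of the
    zeroth power. *)
Lemma equicontinuous_iter (T : Type) (X : uniformType) (g : T -> X -> X)
    (A : set (X * X)) :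
  subsemigroup_action g -> equicontinuous_action g -> sym_entourage A ->
  exists2 B, sym_entourage B &
    forall x y, B (x, y) -> forall t n, A (iter n (g t) x, iter n (g t) y).
Proof.
move=> gM geq symA; have [B [entB Bsym] BA] := geq A symA.
have [entA Asym] := symA.
exists (A `&` B).
  split; first exact: filterI.
  by rewrite -[in RHS]Asym -[in RHS]Bsym.
move=> x y [Axy Bxy] t n.
suff [->|[s gs]] : (iter n (g t) = id) \/ exists s, iter n (g t) = g s.
- by [].
- by rewrite gs; exact: BA.
elim: n => [|n [IH|[s IH]]]; first by left.
  by right; exists t; apply/funext => z; rewrite iterS IH.
right; have [r gr] := gM t s.
by exists r; apply/funext => z; rewrite iterS IH gr.
Qed.

Lemma inverse_equicontinuous (T : Type) (X : uniformType)
    (g h : T -> X -> X) :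
  compact [set: X] -> subsemigroup_action g ->
  (forall t, cancel (g t) (h t)) -> (forall t, cancel (h t) (g t)) ->
  equicontinuous_action g -> equicontinuous_action h.
Proof.
move=> cX gM gK hK geq A [entA _].
have [A' [entA' _] A'A] := sym_entourage_split entA.
have [C symC CA'] := sym_entourage_split entA'; have [entC Csym] := symC.
have [B symB BC] := equicontinuous_iter gM geq symC.
exists B => // x y Bxy t.
have geqt : equicontinuous_action (fun n => iter n (g t)).
  move=> E /(equicontinuous_iter gM geq)[D symD DE].
  by exists D => // u v /DE; apply.
have [n Cn] := uniform_recurrence cX (Bijective (gK t) (hK t)) geqt entC.
(* Recurrence at [h t z]: one of the [n.+1] applications of [g t] cancels [h t]. *)
have hn z : C (h t z, iter n (g t) z).
  by have := Cn (h t z); rewrite iterSr hK.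
apply: (A'A _ (iter n (g t) y)).
  by apply: (CA' _ (iter n (g t) x)) => //; exact: BC.
apply: (CA' _ (h t y)); last exact: entourage_refl.
by rewrite -Csym; exact: hn.
Qed.

Theorem mainTheorem5 (T : monoidType) (X : uniformType)
    (T_infinite : infinite_set [set: T])
    (X_nonempty : [set: X] !=set0)
    (X_compact : compact [set: X])
    (X_hausdorff : hausdorff_space X)
    (F : semiflow T X) (F_invertible : invertible F) :
  [/\ equicontinuous_action F <-> equicontinuous_action (reflection F),
      minimal_action F /\ distal_action F <->
        minimal_action (reflection F) /\ distal_action (reflection F)
    & distal_action F <-> distal_action (reflection F)].
Proof.
have FK := Defs.actK F_invertible; have RK := reflectionK F_invertible.
have FM : subsemigroup_action F.
  by move=> t s; exists (t * s)%g => x; rewrite Defs.actM.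
have RM : subsemigroup_action (reflection F).
  by move=> t s; exists (s * t)%g => x; rewrite reflectionM.
have Fc t : continuous (F t).
  move=> x; apply: (@continuous_comp X (discrete_topology T * X)%type X
    (fun x => (t, x)) (fun p => F p.1 p.2)); last exact: act_continuous.
  move=> V [[A B] /= [tA xB] ABV]; apply: filterS xB => y By.
  by apply: ABV; split=> //=; exact: (@nbhs_singleton (discrete_topology T)).
have Rc t : continuous (reflection F t).
  exact: (compact_bij_inv_continuous X_compact X_hausdorff (Fc t)).
have R_env t : distal_action F -> enveloping F (reflection F t).
  by move=> FD; exact: (enveloping_inverse X_compact X_hausdorff Fc FM FD).
have F_env t : distal_action (reflection F) -> enveloping (reflection F) (F t).
  by move=> RD; exact: (enveloping_inverse X_compact X_hausdorff Rc RM RD).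
have FRD : distal_action F -> distal_action (reflection F).
  by move=> FD; apply: (inverse_distal FD) => t; exact: R_env.
have RFD : distal_action (reflection F) -> distal_action F.
  by move=> RD; apply: (inverse_distal RD) => t; exact: F_env.
split; last by split.
  by split; exact: inverse_equicontinuous.
(* Transferring minimality uses the enveloping semigroup of the target action, so its distality is
   obtained first. *)
split=> [[Fmin FD]|[Rmin RD]].
  split; last exact: FRD.
  by apply: (inverse_minimal Fmin) => t; apply: F_env; exact: FRD.
split; last exact: RFD.
by apply: (inverse_minimal Rmin) => t; apply: R_env; exact: RFD.
Qed.
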